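(* Let $\{\mathbf{x}^k\}_{k\ge 0}$ and $\{\mathbf{y}^k\}_{k\ge 0}$ be the two sequences generated by the Bi-SG Algorithm (Version I or Version II) with parameter $\alpha\in(1/2,1]$. Let $\mathbf{x}'\in X'$, and let $H$ be the associated constant defined in the context. Then for every integer $k\ge1$, $$\varphi(\mathbf{y}^k)-\varphi(\mathbf{x}')\le 2H\cdot\begin{cases}1/k^{\alpha}, & \alpha\in(1/2,1),\\ (\ln(k)+1)/k, & \alpha=1.\end{cases}$$
   Context: Problem. The inner problem is $\min_{\mathbf{x}\in\mathbb{R}^n}\{\varphi(\mathbf{x}):=f(\mathbf{x})+g(\mathbf{x})\}$, where $f:\mathbb{R}^n\to\mathbb{R}$ is convex and continuously differentiable with $L_f$-Lipschitz gradient ($L_f>0$), $g:\mathbb{R}^n\to(-\infty,\infty]$ is proper, lower semicontinuous and convex, and the set $X^*$ of minimizers of $\varphi$ is nonempty. The outer problem is $\min_{\mathbf{x}\in X^*}\omega(\mathbf{x})$, where $\omega:\mathbb{R}^n\to\mathbb{R}$ is convex and coercive ($\omega(\mathbf{x})\to\infty$ as $\|\mathbf{x}\|\to\infty$). $X'$ denotes the set of optimal solutions of the outer problem. The norm $\|\cdot\|$ is the Euclidean norm. Notation. For a smooth convex $s$, a proper lower semicontinuous convex $h$ and $t>0$: $\mathrm{prox}_{th}(\mathbf{x})=\arg\min_{\mathbf{u}}\{t h(\mathbf{u})+\frac12\|\mathbf{u}-\mathbf{x}\|^2\}$, $T_t^{s,h}(\mathbf{x})=\mathrm{prox}_{th}(\mathbf{x}-t\nabla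 s(\mathbf{x}))$, and the gradient mapping is $G_t^{s,h}(\mathbf{x})=\frac1t(\mathbf{x}-T_t^{s,h}(\mathbf{x}))$. A mapping $F:\mathbb{R}^n\to\mathbb{R}^n$ is quasi Lipschitz with constants $(d_1,d_2)$, $d_1,d_2\ge0$, if $\|F(\mathbf{x})\|\le\max\{d_1,d_2\|\mathbf{x}\|\}$ for all $\mathbf{x}$. Bi-SG Algorithm. Input $\alpha\in(1/2,1]$, $c>0$, and $\eta_k=c(k+1)^{-\alpha}$. Start from any $\mathbf{x}^0\in\mathbb{R}^n$. For $k=0,1,2,\dots$: $\mathbf{y}^k=T_{t_k}^{f,g}(\mathbf{x}^k)$ with $t_k=1/L_k$, then $\mathbf{x}^{k+1}=\mathbf{y}^k-\eta_k\Omega_k(\mathbf{y}^k)$, where: - Version I: $c\le1$; $\Omega_k=\Omega$ for all $k$, where $\Omega:\mathbb{R}^n\to\mathbb{R}^n$ satisfies $\Omega(\mathbf{x})\in\partial\omega(\mathbf{x})$ for all $\mathbf{x}$ and $\Omega$ is quasi Lipschitz (such a selection is assumed to exist). - Version II: it is assumed that $\omega=\sigma+\psi$ with $\sigma:\mathbb{R}^n\to\mathbb{R}$ convex, continuously differentiable with $L_\sigma$-Lipschitz gradient ($L_\sigma>0$) and $\psi:\mathbb{R}^n\to\mathbb{R}$ proper, lower semicontinuous and convex; $c\le\min\{1/L_\sigma,1\}$; $\Omega_k=G_{\eta_k}^{\sigma,\psi}$, i.e. $\mathbf{x}^{k+1}=\mathrm{prox}_{\eta_k\psi}(\mathbf{y}^k-\eta_k\nabla\sigma(\mathbf{y}^k))$.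 Step-sizes. Either constant, $L_k=L_f$ for all $k$, in which case $\bar L:=L_f$; or backtracking with parameters $\gamma>0$, $\rho>1$: $L_{-1}=\gamma$ and $L_k=L_{k-1}\rho^{i_k}$, where $i_k$ is the smallest non-negative integer such that, with $t_k=1/L_k$, $f(T_{t_k}^{f,g}(\mathbf{x}^k))\le f(\mathbf{x}^k)+\langle\nabla f(\mathbf{x}^k),T_{t_k}^{f,g}(\mathbf{x}^k)-\mathbf{x}^k\rangle+\frac{L_k}{2}\|T_{t_k}^{f,g}(\mathbf{x}^k)-\mathbf{x}^k\|^2$; in this case $\bar L:=\max\{L_f\rho,\gamma\}$. Constants. For the given $\mathbf{x}'\in X'$, $D_1,D_2>0$ are constants with $\|\mathbf{x}^k-\mathbf{x}'\|\le D_1$ and $\|\Omega_k(\mathbf{y}^k)\|\le D_2$ for all $k\ge0$ (such constants exist). Set $D=D_1+D_2$, and $H=D^2\bar L/(1-\alpha)$ if $\alpha\in(1/2,1)$, $H=D^2\bar L$ if $\alpha=1$. *)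

(* Defs.v *)
From mathcomp Require Import all_boot all_order all_algebra.
From mathcomp Require Import all_classical all_reals all_analysis.
Import Order.TTheory GRing.Theory Num.Theory.
Import numFieldNormedType.Exports.

Set Implicit Arguments.
Unset Strict Implicit.
Unset Printing Implicit Defensive.

Local Open Scope classical_set_scope.
Local Open Scope ring_scope.

Section Euclidean.
Context {R : realType} {n : nat}.
Local Notation E := 'rV[R]_n.

Definition dotv (u v : E) : R := \sum_(i < n) u 0 i * v 0 i.

(* The library norm [`|u|] on ['rV_n] is the sup norm. It induces the same
   topology, but not the same Lipschitz constants, as the Euclidean norm. *)
Definition enorm (u : E) : R := Num.sqrt (dotv u u).

Definition grad (s : E -> R) (x : E) : E := \row_(i < n) 'D_('e_i) s x.

Definition smooth_convex (L : R) (s : E -> R) : Prop :=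
  [/\ convex_function [set: convex_lmodType E] s,
      (forall x, differentiable s x),
      continuous (grad s) &
      forall x y, enorm (grad s x - grad s y) <= L * enorm (x - y)].

(* No indeterminate [+oo - oo] occurs on the right-hand side since this is only
   used for functions that avoid [-oo]; the product follows [0 * +oo = 0]. *)
Definition econvex (h : E -> \bar R) : Prop :=
  forall (x y : E) (t : R), 0 <= t <= 1 ->
    (h (t *: x + (1 - t) *: y)%R <= t%:E * h x + (1 - t)%:E * h y)%E.

Definition proper (h : E -> \bar R) : Prop :=
  (forall x, (-oo < h x)%E) /\ (exists x, (h x < +oo)%E).

Definition proper_lsc_convex (h : E -> \bar R) : Prop :=
  [/\ proper h, lower_semicontinuous h & econvex h].

Definition coercive (w : E -> R) : Prop :=
  forall M : R, exists r : R, forall x, r <= enorm x -> M <= w x.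

Definition subdifferential (w : E -> R) (x : E) : set E :=
  [set v | forall z, w x + dotv v (z - x) <= w z].

Definition quasi_lipschitz (F : E -> E) : Prop :=
  exists d1 d2 : R, [/\ 0 <= d1, 0 <= d2 &
    forall x, enorm (F x) <= Num.max d1 (d2 * enorm x)].

Definition argmin (S : set E) (F : E -> \bar R) : set E :=
  [set u | S u /\ forall v, S v -> (F u <= F v)%E].

(* For [0 < t] and [h] proper, lower semicontinuous and convex the set of
   minimizers is a singleton; the default value 0 is then irrelevant. *)
Definition prox (t : R) (h : E -> \bar R) (x : E) : E :=
  xget 0 (argmin setT
    (fun u => t%:E * h u + (2^-1 * enorm (u - x)%R ^+ 2)%:E)%E).

Definition prox_grad (t : R) (s : E -> R) (h : E -> \bar R) (x : E) : E :=
  prox t h (x - t *: grad s x).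

Definition grad_mapping (t : R) (s : E -> R) (h : E -> \bar R) (x : E) : E :=
  t^-1 *: (x - prox_grad t s h x).

Definition inner_obj (f : E -> R) (g : E -> \bar R) (x : E) : \bar R :=
  ((f x)%:E + g x)%E.

Definition inner_sol (f : E -> R) (g : E -> \bar R) : set E :=
  argmin setT (inner_obj f g).

Definition outer_sol (f : E -> R) (g : E -> \bar R) (w : E -> R) : set E :=
  argmin (inner_sol f g) (EFin \o w).

Definition outer_step (c alpha : R) (k : nat) : R :=
  c * k.+1%:R `^ (- alpha).

Definition version_I (w : E -> R) (c : R) (Omega : nat -> E -> E) : Prop :=
  c <= 1 /\
  exists Om : E -> E,
    [/\ (forall x, subdifferential w x (Om x)), quasi_lipschitz Om &
        forall k, Omega k = Om].

Definition version_II (w : E -> R) (c alpha : R) (Omega : nat -> E -> E) :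
    Prop :=
  exists (sigma psi : E -> R) (Lsigma : R),
    [/\ 0 < Lsigma,
        smooth_convex Lsigma sigma /\ proper_lsc_convex (EFin \o psi),
        (forall x, w x = sigma x + psi x),
        c <= Num.min (1 / Lsigma) 1 &
        forall k, Omega k =
          grad_mapping (outer_step c alpha k) sigma (EFin \o psi)].

Definition sufficient_decrease (f : E -> R) (g : E -> \bar R) (L : R) (x : E) :
    Prop :=
  let z := prox_grad (1 / L) f g x in
  f z <= f x + dotv (grad f x) (z - x) + L / 2 * enorm (z - x) ^+ 2.

Definition constant_rule (Lf : R) (L : nat -> R) (Lbar : R) : Prop :=
  (forall k, L k = Lf) /\ Lbar = Lf.

(* [Lprev k] stands for L_(k-1), with L_(-1) = gamma. *)
Definition backtracking_rule (f : E -> R) (g : E -> \bar R) (Lf : R)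
    (x : nat -> E) (L : nat -> R) (Lbar : R) : Prop :=
  exists gamma rho : R,
    let Lprev k := if k is j.+1 then L j else gamma in
    [/\ 0 < gamma, 1 < rho,
        (forall k, exists i : nat,
          [/\ L k = Lprev k * rho ^+ i,
              sufficient_decrease f g (Lprev k * rho ^+ i) (x k) &
              forall j, (j < i)%N ->
                ~ sufficient_decrease f g (Lprev k * rho ^+ j) (x k)]) &
        Lbar = Num.max (Lf * rho) gamma].

End Euclidean.

Definition H_const {R : realType} (alpha D Lbar : R) : R :=
  if alpha == 1 then D ^+ 2 * Lbar else D ^+ 2 * Lbar / (1 - alpha).

Definition rate {R : realType} (alpha : R) (k : nat) : R :=
  if alpha == 1 then (ln k%:R + 1) / k%:R else 1 / k%:R `^ alpha.

(* Main.v *)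
Require Import Defs.
From mathcomp Require Import all_boot all_order all_algebra.
From mathcomp Require Import all_classical all_reals all_analysis.
From mathcomp Require Import ring lra.
Import Order.TTheory GRing.Theory Num.Theory.
Import numFieldNormedType.Exports.

(** Write [phi = f + g], [a_k = phi (y_k) - phi (x')] and [theta_k = k^-alpha].
    A proximal gradient step with step size [1 / L] satisfies
    [phi (y_k) <= phi z + L / 2 * |x_k - z|^2] for every [z]
    ([prox_grad_ineq]). The idea is to choose for [z] neither the solution [x']
    nor the previous iterate, but the convex combination
    [theta_k x' + (1 - theta_k) y_(k-1)]. Convexity bounds [phi z], and
    [x_k - z = theta_k (x_k - x') - (1 - theta_k) eta_(k-1) Omega (y_(k-1))] has
    norm at most [theta_k (D1 + D2)] because [eta_(k-1) = c theta_k <= theta_k].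
    With [B = Lbar (D1 + D2)^2 / 2] this is the recursion
    [a_k <= (1 - theta_k) a_(k-1) + B theta_k^2]
    ([perturbed_prox_grad_contraction]), in which the outer function enters only
    through the bound [D2] on its directions.

    The recursion gives [a_k <= B (ln k + 1) / k] for [alpha = 1]
    ([harmonic_rate]) and [a_k <= B / (1 - alpha) / k^alpha] for [alpha < 1]
    ([powR_rate]); both are a quarter of the stated bound.

    Two facts feed [prox_grad_ineq]. First, proximal points exist: optimality of
    a minimizer of [phi] yields an affine minorant of [g]
    ([inner_sol_subgradient]), hence a quadratic minorant of the proximal
    objective, which attains its minimum by compactness and lower
    semicontinuity ([lsc_quadratic_min]). Second, the sufficient decrease
    condition holds along the iteration with [L_k <= Lbar], by the descent lemma
    ([descent_lemma], [stepsize_bounds]). *)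

Local Open Scope classical_set_scope.
Local Open Scope ring_scope.

(** * Euclidean geometry *)

Section EuclideanGeometry.
Context {R : realType} {n : nat}.
Implicit Types (u v w : 'rV[R]_n).

Lemma dotvC u v : dotv u v = dotv v u.
Proof. by apply: eq_bigr => i _; rewrite mulrC. Qed.

Lemma dotvDl u v w : dotv (u + v) w = dotv u w + dotv v w.
Proof.
by rewrite /dotv -big_split; apply: eq_bigr => i _; rewrite mxE mulrDl.
Qed.

Lemma dotvZl (a : R) u v : dotv (a *: u) v = a * dotv u v.
Proof.
by rewrite /dotv mulr_sumr; apply: eq_bigr => i _; rewrite mxE mulrA.
Qed.

Lemma dotvNl u v : dotv (- u) v = - dotv u v.
Proof. by rewrite -scaleN1r dotvZl mulN1r. Qed.

Lemma dotvDr u v w : dotv u (v + w) = dotv u v + dotv u w.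
Proof. by rewrite dotvC dotvDl !(dotvC u). Qed.

Lemma dotvZr (a : R) u v : dotv u (a *: v) = a * dotv u v.
Proof. by rewrite dotvC dotvZl dotvC. Qed.

Lemma dotvNr u v : dotv u (- v) = - dotv u v.
Proof. by rewrite dotvC dotvNl dotvC. Qed.

Definition dotvE := (dotvDl, dotvDr, dotvZl, dotvZr, dotvNl, dotvNr).

Lemma dotv_ge0 u : 0 <= dotv u u.
Proof. by apply: sumr_ge0 => i _; rewrite -expr2 sqr_ge0. Qed.

Lemma enorm_ge0 u : 0 <= enorm u.
Proof. exact: sqrtr_ge0. Qed.

Lemma enorm_sqr u : enorm u ^+ 2 = dotv u u.
Proof. by rewrite sqr_sqrtr// dotv_ge0. Qed.

Lemma sqr_enorm_line u v (s : R) : enorm (u + s *: v) ^+ 2 =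
  enorm u ^+ 2 + 2 * s * dotv u v + s ^+ 2 * enorm v ^+ 2.
Proof. by rewrite !enorm_sqr !dotvE (dotvC v u); ring. Qed.

Lemma normr_coord_le_enorm u i : `|u 0 i| <= enorm u.
Proof.
rewrite -(@ler_pXn2r _ 2)// ?nnegrE ?enorm_ge0// enorm_sqr real_normK ?num_real//.
by rewrite /dotv (bigD1 i)//= expr2 lerDl sumr_ge0// => j _; rewrite -expr2 sqr_ge0.
Qed.

(** Expanding the square of the norm of [q u - p v] gives Cauchy-Schwarz for
    any two upper bounds [p], [q] of the norms; degenerate bounds force one of
    the vectors to vanish. *)
Lemma dotv_le_mul u v (p q : R) :
  enorm u <= p -> enorm v <= q -> dotv u v <= p * q.
Proof.
move=> up vq.
have zero w r : enorm w <= r -> r <= 0 -> w = 0.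
  move=> wr r0; apply/rowP => i; rewrite mxE; apply/eqP; rewrite -normr_le0.
  exact: le_trans (normr_coord_le_enorm w i) (le_trans wr r0).
have p0 : 0 <= p := le_trans (enorm_ge0 u) up.
have q0 : 0 <= q := le_trans (enorm_ge0 v) vq.
have d0 w : dotv 0 w = 0 by rewrite -(scale0r 0) dotvZl mul0r.
have [ple0|p_gt0] := leP p 0.
  by rewrite (zero _ _ up ple0) d0 mulr_ge0.
have [qle0|q_gt0] := leP q 0.
  by rewrite (zero _ _ vq qle0) dotvC d0 mulr_ge0.
have := dotv_ge0 (q *: u - p *: v).
rewrite !dotvE (dotvC v u).
have upp : dotv u u <= p ^+ 2 by rewrite -enorm_sqr lerXn2r// nnegrE enorm_ge0.
have vqq : dotv v v <= q ^+ 2 by rewrite -enorm_sqr lerXn2r// nnegrE enorm_ge0.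
move=> sq_ge0; rewrite -(ler_pM2l (mulr_gt0 p_gt0 q_gt0)).
have h1 := ler_wpM2l (sqr_ge0 q) upp.
have h2 := ler_wpM2l (sqr_ge0 p) vqq.
by nra.
Qed.

End EuclideanGeometry.

(** * Gradients of smooth convex functions *)

Section Smooth.
Context {R : realType} {n : nat}.
Implicit Types (f : 'rV[R]_n -> R) (x z v : 'rV[R]_n).

Lemma derive_grad f x v : differentiable f x -> 'D_v f x = dotv (grad f x) v.
Proof.
move=> df; rewrite deriveE// {1}(row_sum_delta v) linear_sum /dotv.
by apply: eq_bigr => i _; rewrite linearZ /= mxE -deriveE// mulrC.
Qed.

Lemma is_derive_line f x v (t : R) : differentiable f (x + t *: v) ->
  is_derive t 1 (fun s => f (x + s *: v)) (dotv (grad f (x + t *: v)) v).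
Proof.
move=> df; rewrite -derive_grad//.
have quotientE : (fun h : R => h^-1 *: (((fun s => f (x + s *: v)) \o shift t)
    (h *: 1) - f (x + t *: v))) =
    (fun h : R => h^-1 *: ((f \o shift (x + t *: v)) (h *: v) - f (x + t *: v))).
  apply/funext => h /=; congr (_ *: (f _ - _)).
  have -> : h *: (1 : R) = h by rewrite /GRing.scale /= mulr1.
  by rewrite scalerDl addrCA.
by split; [rewrite /derivable | rewrite /derive]; rewrite quotientE//;
   exact: diff_derivable.
Qed.

(** On a segment the gap between [f] and its quadratic upper model has
    derivative [<grad f (x + t v) - grad f x, v> - t L |v|^2], which the
    Lipschitz bound makes nonpositive. *)
Lemma descent_lemma (L : R) f x z : (forall u, differentiable f u) ->
  (forall u w, enorm (grad f u - grad f w) <= L * enorm (u - w)) ->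
  f z <= f x + dotv (grad f x) (z - x) + L / 2 * enorm (z - x) ^+ 2.
Proof.
move=> df lip; set v := z - x.
pose gap (t : R) :=
  f (x + t *: v) - t * dotv (grad f x) v - t ^+ 2 * (L / 2 * enorm v ^+ 2).
pose dgap (t : R) := dotv (grad f (x + t *: v)) v - dotv (grad f x) v
  - 2 * t * (L / 2 * enorm v ^+ 2).
have gapD (t : R) : is_derive t 1 gap (dgap t).
  have fD := @is_derive_line f x v t (df _).
  rewrite /gap /dgap; apply: is_derive_eq.
  by rewrite /GRing.scale /=; ring.
have gap_cont : {within `[0, 1]%classic, continuous gap}.
  apply: continuous_subspaceT => t.
  by apply: differentiable_continuous; apply/derivable1_diffP; case: (gapD t).
have : gap 1 <= gap 0.
  apply: (@ler0_derive1_le_cc _ gap 0 1) => //; rewrite ?in_itv /= ?lexx ?ler01//.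
  move=> t; rewrite in_itv /= => /andP[t0 _].
  rewrite derive1E (@derive_val _ _ _ _ _ _ _ (gapD t)) /dgap.
  have tv : enorm (t *: v) = t * enorm v.
    by rewrite /enorm !dotvE mulrA sqrtrM ?sqr_ge0 -?expr2 ?sqr_ge0// sqrtr_sqr gtr0_norm.
  have := lip (x + t *: v) x; rewrite addrAC subrr add0r tv => lipt.
  have := @dotv_le_mul _ _ _ v _ _ lipt (lexx _).
  by rewrite !dotvE; nra.
rewrite /gap scale1r scale0r addr0 /v addrCA subrr addr0 -/v.
by rewrite !mul0r expr0n /= mul0r expr1n !mul1r !subr0; lra.
Qed.

(** A one-sided bound on difference quotients passes to the limit. The tangent
    inequality (through [- f]) and first-order optimality are both instances. *)
Lemma derive_ge_slope f x v (c : R) : derivable f x v ->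
  (forall s, 0 < s <= 1 -> f x + s * c <= f (x + s *: v)) -> c <= 'D_v f x.
Proof.
move=> df slope.
have lim0 : (h^-1 *: ((f \o shift x) (h *: v) - f x)) @[h --> (0 : R)^'+] -->
    'D_v f x := cvg_dnbhs_at_right df.
rewrite -(cvg_lim _ lim0)//; apply: limr_ge; first by apply/cvg_ex; exists ('D_v f x).
near=> h.
have h0 : 0 < h by near: h; exact: nbhs_right_gt.
have h1 : h <= 1 by near: h; exact: nbhs_right_le.
have := slope h; rewrite h0 h1 => /(_ isT) hs.
by rewrite /GRing.scale /= ler_pdivlMl// [h *: v + x]addrC; lra.
Unshelve. all: by end_near.
Qed.

Lemma convex_gradient_ineq f x z :
  convex_function [set: convex_lmodType 'rV[R]_n] f -> differentiable f x ->
  f x + dotv (grad f x) (z - x) <= f z.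
Proof.
move=> fconv df; rewrite -derive_grad//.
have dv : derivable f x (z - x) by exact: diff_derivable.
suff : - (f z - f x) <= - 'D_(z - x) f x by lra.
rewrite -deriveN//; apply: derive_ge_slope; first exact: derivableN.
move=> s /andP[s0 s1] /=.
have s01 : 0 <= s <= 1 by rewrite ltW.
have := fconv (Itv01 (ltW s0) s1) z x (mem_setT _) (mem_setT _).
rewrite convRE /= /unstable.onem.
have -> : (conv (Itv01 (ltW s0) s1) (z : convex_lmodType 'rV[R]_n) x) =
    x + s *: (z - x) :> 'rV[R]_n.
  rewrite /conv /= /unstable.onem scalerBl scale1r scalerBr.
  by rewrite addrCA addrA.
by move=> le; rewrite fctE; lra.
Qed.

End Smooth.

(** * Existence and variational characterization of proximal points *)

Section ProximalMap.
Context {R : realType} {n : nat}.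
Implicit Types (g : 'rV[R]_n -> \bar R) (x z w p u v : 'rV[R]_n).

Lemma ereal_dense_right (a : R) (y : \bar R) : (a%:E < y)%E ->
  exists2 b : R, a < b & (b%:E < y)%E.
Proof.
case: y => [r| |]//; last by exists (a + 1); rewrite ?ltry// ltrDl.
by rewrite lte_fin => ar; exists ((a + r) / 2); rewrite ?lte_fin; lra.
Qed.

(** The direct method: the quadratic minorant bounds a minimizing sequence, a
    cluster point of which minimizes [F] by lower semicontinuity. *)
Lemma lsc_quadratic_min (F : 'rV[R]_n -> \bar R) u0 w (b : R) :
  lower_semicontinuous F -> (F u0 < +oo)%E ->
  (forall u, ((b + 2^-1 * enorm (u - w) ^+ 2)%:E <= F u)%E) ->
  exists p, forall v, (F p <= F v)%E.
Proof.
move=> Flsc Fu0 Fq.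
have inf_le v : (ereal_inf (range F) <= F v)%E.
  by apply: ereal_inf_lbound; exists v.
have inf_ge : (b%:E <= ereal_inf (range F))%E.
  apply: le_ereal_inf_tmp => _ [u _ <-]; apply: le_trans (Fq u).
  by rewrite lee_fin lerDl mulr_ge0// ?invr_ge0// sqr_ge0.
case inf_eq : (ereal_inf (range F)) inf_ge inf_le => [m| |] inf_ge inf_le//;
  last first.
  by have := le_lt_trans (inf_le u0) Fu0; rewrite ltxx.
have /choice[u_ u_min] : forall k : nat, exists u, (F u < (m + k.+1%:R^-1)%:E)%E.
  move=> k; have : (0 : R) < k.+1%:R^-1 by rewrite invr_gt0.
  move=> /(@lb_ereal_inf_adherent _ (range F)).
  by rewrite inf_eq => /(_ isT)[_ [u _ <-]]; exists u.
(* [|u - w| <= (|u - w|^2 + 1) / 2], so a bound on the square suffices. *)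
pose r := 2 * (m + 1 - b) + 1.
have u_bounded k i : w 0 i - r <= u_ k 0 i <= w 0 i + r.
  have := le_lt_trans (Fq (u_ k)) (u_min k); rewrite lte_fin => lt.
  have k1 : (k.+1%:R^-1 : R) <= 1 by rewrite invf_le1// ler1n.
  have := normr_coord_le_enorm (u_ k - w) i; rewrite !mxE => coord.
  have N1 := sqr_ge0 (enorm (u_ k - w) - 1).
  have : `|u_ k 0 i - w 0 i| <= r.
    move: inf_ge lt k1 coord N1; rewrite lee_fin /r.
    by move: (enorm _) (k.+1%:R^-1) => N e; lra.
  by rewrite ler_norml; lra.
have := @rV_compact R n (fun i => `[w 0 i - r, w 0 i + r]%classic)
  (fun i => @segment_compact _ _ _).
move=> /(_ (u_ @ \oo) (fmap_proper_filter _ _)) [|p [_ p_cluster]].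
  by exists 0%N => // k _ i /=; rewrite in_itv /= u_bounded.
exists p => v; apply: le_trans (inf_le v); rewrite leNgt; apply/negP.
move=> /ereal_dense_right[a ma /(Flsc p a)[V Vp VF]].
have near_inf : (u_ @ \oo) [set y | (F y < a%:E)%E].
  have am : 0 < a - m by lra.
  have := near_infty_natSinv_lt (PosNum am); apply: filterS => k /= k_lt.
  by apply: lt_trans (u_min k) _; rewrite lte_fin -ltrBrDl.
have [y [/= ya /VF]] := p_cluster _ _ near_inf Vp.
by move=> /(lt_trans ya); rewrite ltxx.
Qed.

Lemma continuous_sqr_dist w : continuous (fun u => 2^-1 * enorm (u - w) ^+ 2).
Proof.
move=> u; suff sqr_cvg : enorm (v - w) ^+ 2 @[v --> u] --> enorm (u - w) ^+ 2.
  exact: cvgMr sqr_cvg.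
under eq_fun do rewrite enorm_sqr.
rewrite enorm_sqr /dotv.
pose sq i (v : 'rV[R]_n) : R := (v - w) 0 i * (v - w) 0 i.
apply: (@continuous_big _ _ _ _ xpredT (@add_continuous R) _ _ sq) => i _ {}u.
have coord : continuous (fun v : 'rV[R]_n => (v - w) 0 i).
  under eq_fun do rewrite !mxE.
  move=> v; apply: continuousB; [exact: coord_continuous|exact: cst_continuous].
exact: continuousM (coord u) (coord u).
Qed.

Lemma lsc_prox_objective (t : R) g x : 0 < t -> lower_semicontinuous g ->
  lower_semicontinuous (fun u =>
    (t%:E * g u + (2^-1 * enorm (u - x)%R ^+ 2)%:E)%E).
Proof.
move=> t0 glsc u a; set q := fun v => 2^-1 * enorm (v - x) ^+ 2.
rewrite -/(q u) => a_lt.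
have : (((a - q u) / t)%:E < g u)%E.
  case: (g u) a_lt => [r| |]//.
  - rewrite -EFinM -EFinD !lte_fin => lt; rewrite ltr_pdivrMr//; lra.
  - by rewrite ltry.
  - by rewrite mulr_infty gtr0_sg// mul1e.
move=> /ereal_dense_right[b ab /(glsc u b)[V Vu Vg]].
move: ab; rewrite ltr_pdivrMr// => ab.
have q_near : \forall v \near u, a - t * b < q v.
  by apply: (cvgr_gt _ (@continuous_sqr_dist x u)); rewrite -/(q u); lra.
exists (V `&` [set v | a - t * b < q v]); first exact: filterI.
move=> v [/Vg bg /=]; rewrite -/(q v); case: (g v) bg => [r| |]//.
- by rewrite -EFinM -EFinD !lte_fin => br qv; nra.
- by move=> _ _; rewrite mulr_infty gtr0_sg// mul1e addye// ltry.
Qed.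

(** An affine minorant of [g] turns into a quadratic one of the proximal
    objective by completing the square. *)
Lemma prox_argmin (t : R) g x u0 v (c : R) : 0 < t -> lower_semicontinuous g ->
  (g u0 < +oo)%E -> (forall u, ((c + dotv v u)%:E <= g u)%E) ->
  forall u, (t%:E * g (prox t g x)
               + (2^-1 * enorm (prox t g x - x)%R ^+ 2)%:E <=
             t%:E * g u + (2^-1 * enorm (u - x)%R ^+ 2)%:E)%E.
Proof.
move=> t0 glsc gu0 gaff.
suff [p p_min] : exists p, argmin setT
    (fun u => t%:E * g u + (2^-1 * enorm (u - x)%R ^+ 2)%:E)%E p.
  by have [_ min_p] := xgetPex 0 (ex_intro _ p p_min) => u; exact: min_p.
have [||p p_min] := @lsc_quadratic_min _ u0 (x - t *: v)
    (t * c + t * dotv v x - 2^-1 * t ^+ 2 * dotv v v)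
    (lsc_prox_objective _ _ x t0 glsc).
- have gNy : (-oo < g u0)%E := lt_le_trans (ltNyr _) (gaff u0).
  by case: (g u0) gNy gu0 => [r| |]// _ _; rewrite -EFinM -EFinD ltry.
- move=> u; have := gaff u; case: (g u) => [r| |]//.
  + rewrite -EFinM -EFinD !lee_fin !enorm_sqr !dotvE (dotvC u v) (dotvC x v).
    by rewrite (dotvC x u) => le; nra.
  + by move=> _; rewrite mulr_infty gtr0_sg// mul1e addye// leey.
- by exists p; split.
Qed.

(** At the point [p + s (z - p)] the objective exceeds its value at [p] by at
    most [s A + s^2 B]. As [p] is a minimizer this is nonnegative for all small
    [s], hence [A >= 0], which is the claim rearranged. *)
Lemma prox_three_point (t : R) g w p z (gz : R) : 0 < t -> econvex g ->
  (forall u, (-oo < g u)%E) -> g z = gz%:E ->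
  (forall u, (t%:E * g p + (2^-1 * enorm (p - w)%R ^+ 2)%:E <=
             t%:E * g u + (2^-1 * enorm (u - w)%R ^+ 2)%:E)%E) ->
  exists2 gp : R, g p = gp%:E &
    t * gp + 2^-1 * enorm (p - w) ^+ 2 + 2^-1 * enorm (z - p) ^+ 2 <=
    t * gz + 2^-1 * enorm (z - w) ^+ 2.
Proof.
move=> t0 gconv gNy gzE p_min.
case gpE : (g p) => [gp| |]; last 2 first.
- by have := p_min z; rewrite gpE gzE mulr_infty gtr0_sg// mul1e addye.
- by have := gNy p; rewrite gpE.
exists gp => //.
pose A := t * (gz - gp) + dotv (p - w) (z - p).
pose B := 2^-1 * dotv (z - p) (z - p).
have B0 : 0 <= B by rewrite mulr_ge0 ?invr_ge0 ?dotv_ge0.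
have AB s : 0 < s -> s <= 1 -> 0 <= A + s * B.
  move=> s0 s1; have s01 : 0 <= s <= 1 by rewrite ltW.
  have := gconv z p s s01; rewrite gzE gpE.
  have := p_min (s *: z + (1 - s) *: p); have := gNy (s *: z + (1 - s) *: p).
  have -> : s *: z + (1 - s) *: p = p + s *: (z - p).
    by rewrite scalerBl scale1r scalerBr addrCA.
  rewrite gpE; case: (g _) => [gs| |]// _.
  rewrite -!EFinM -!EFinD !lee_fin addrAC sqr_enorm_line => le1 le2.
  have := ler_wpM2l (ltW t0) le2 => le3.
  by rewrite -(pmulr_rge0 _ s0) /A /B -enorm_sqr; lra.
have A0 : 0 <= A.
  rewrite leNgt; apply/negP => A0.
  (* [s = - A / (2 B - A)] lies in ]0, 1] and makes [A + s B] negative. *)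
  have d0 : 0 < 2 * B - A by lra.
  have s0 : 0 < - A / (2 * B - A) by rewrite divr_gt0//; lra.
  have s1 : - A / (2 * B - A) <= 1 by rewrite ler_pdivrMr//; lra.
  have := AB _ s0 s1.
  have -> : A + - A / (2 * B - A) * B = A * (B - A) / (2 * B - A).
    by field; lra.
  by rewrite pmulr_lge0 ?invr_gt0//; nra.
rewrite !enorm_sqr; move: A0; rewrite /A !dotvE (dotvC w p) (dotvC z p) (dotvC w z).
by lra.
Qed.

End ProximalMap.

(** * The proximal gradient step *)

Section ProximalGradient.
Context {R : realType} {n : nat}.
Context (f : 'rV[R]_n -> R) (g : 'rV[R]_n -> \bar R) (Lf : R)
  (f_smooth : smooth_convex Lf f) (g_plc : proper_lsc_convex g).
Implicit Types (x z p u : 'rV[R]_n).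

Lemma inner_sol_fin x : inner_sol f g x -> exists r : R, g x = r%:E.
Proof.
have [[gNy [u gu]] _ _] := g_plc; move=> [_ /(_ u I)].
move: (gNy u) (gNy x) gu; rewrite /inner_obj.
by case: (g u) => [r| |]//; case: (g x) => [s| |]// _ _ _ _; exists s.
Qed.

(** First-order optimality: [- grad f x] is a subgradient of [g] at a minimizer
    [x] of [f + g]. Besides being the optimality condition, it supplies the affine
    minorant of [g] from which existence of proximal points follows, without a
    separation theorem. *)
Lemma inner_sol_subgradient x (gx : R) : inner_sol f g x -> g x = gx%:E ->
  forall u, ((gx - dotv (grad f x) (u - x))%:E <= g u)%E.
Proof.
have [_ df _ _] := f_smooth; have [[gNy _] _ gconv] := g_plc.
move=> [_ x_min] gxE u; case guE : (g u) => [gu| |]; last 2 first.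
- by rewrite leey.
- by have := gNy u; rewrite guE.
rewrite lee_fin.
suff : - (gu - gx) <= 'D_(u - x) f x by rewrite derive_grad//; lra.
apply: derive_ge_slope; first exact: diff_derivable.
move=> s /andP[s0 s1]; have s01 : 0 <= s <= 1 by rewrite ltW.
have := gconv u x s s01; have := x_min (x + s *: (u - x)) I.
have := gNy (x + s *: (u - x)).
have -> : s *: u + (1 - s) *: x = x + s *: (u - x).
  by rewrite scalerBl scale1r scalerBr addrCA.
rewrite /inner_obj gxE guE; case: (g _) => [gs| |]// _.
by rewrite -!EFinM -!EFinD !lee_fin; lra.
Qed.

Lemma prox_grad_argmin (t : R) x : inner_sol f g !=set0 -> 0 < t ->
  let w := x - t *: grad f x in let p := prox_grad t f g x in
  forall u, (t%:E * g p + (2^-1 * enorm (p - w)%R ^+ 2)%:E <=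
             t%:E * g u + (2^-1 * enorm (u - w)%R ^+ 2)%:E)%E.
Proof.
move=> [x0 x0_min] t0 /=.
have [[_ [u0 gu0]] glsc _] := g_plc.
have [g0 g0E] := inner_sol_fin _ x0_min.
apply: (prox_argmin _ _ _ u0 (- grad f x0) (g0 + dotv (grad f x0) x0)) => // u.
have := inner_sol_subgradient _ _ x0_min g0E u; congr (_ <= _)%E.
by congr EFin; rewrite !dotvE; ring.
Qed.

(** The three-point inequality for [g], the quadratic upper model of [f] at
    [x] and the tangent lower bound of [f] at [x] add up; the linear terms in
    [grad f x] cancel. *)
Lemma prox_grad_ineq (L : R) x z (gz : R) : inner_sol f g !=set0 -> 0 < L ->
  sufficient_decrease f g L x -> g z = gz%:E ->
  exists2 gp : R, g (prox_grad (1 / L) f g x) = gp%:E &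
    f (prox_grad (1 / L) f g x) + gp <= f z + gz + L / 2 * enorm (x - z) ^+ 2.
Proof.
move=> sol L0; rewrite /sufficient_decrease; set p := prox_grad _ _ _ _ => /= dec gzE.
have [fconv df _ _] := f_smooth; have [[gNy _] _ gconv] := g_plc.
have t0 : 0 < 1 / L by rewrite divr_gt0.
have [gp gpE three] := prox_three_point _ _ _ _ _ _ t0 gconv gNy gzE
  (prox_grad_argmin _ x sol t0).
exists gp => //.
have tangent := convex_gradient_ineq _ _ z fconv (df x).
have shift u : enorm (u - (x - (1 / L) *: grad f x)) ^+ 2 =
    enorm (u - x) ^+ 2 + 2 / L * dotv (grad f x) (u - x)
    + (1 / L) ^+ 2 * enorm (grad f x) ^+ 2.
  by rewrite opprB addrCA addrC sqr_enorm_line dotvC; ring.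
move: three; rewrite -/p !shift => three.
have sq := sqr_ge0 (enorm (z - p)).
have -> : enorm (x - z) ^+ 2 = enorm (z - x) ^+ 2.
  by rewrite !enorm_sqr -opprB !dotvE; ring.
have {}three : 1 / L * gp + 2^-1 * enorm (p - x) ^+ 2
    + 1 / L * dotv (grad f x) (p - x) <= 1 / L * gz
    + 2^-1 * enorm (z - x) ^+ 2 + 1 / L * dotv (grad f x) (z - x).
  lra.
have LV : L * (1 / L) = 1 by rewrite mul1r divff// gt_eqF.
have := ler_wpM2l (ltW L0) three.
by rewrite !mulrDr ![L * (1 / L * _)]mulrA LV !mul1r; move: dec tangent; lra.
Qed.

(** By the descent lemma every rejected backtracking trial lies below [Lf]. The
    accepted value is [rho] times the last rejected one, so each increase ends
    below [Lf rho], and without any increase [L] stays at [gamma]. *)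
Lemma stepsize_bounds (x : nat -> 'rV[R]_n) (L : nat -> R) (Lbar : R) : 0 < Lf ->
  constant_rule Lf L Lbar \/ backtracking_rule f g Lf x L Lbar ->
  forall k, [/\ 0 < L k, L k <= Lbar & sufficient_decrease f g (L k) (x k)].
Proof.
move=> Lf0; have [_ df _ lip] := f_smooth.
have dec M z : Lf <= M -> sufficient_decrease f g M z.
  move=> LfM; rewrite /sufficient_decrease /=.
  apply: le_trans (descent_lemma _ _ z _ df lip) _.
  by rewrite lerD2l ler_wpM2r ?sqr_ge0// ler_pM2r// invr_gt0.
move=> [[LE ->] k|[gamma [rho [gamma0 rho1 Lrule ->]]]].
  by rewrite LE; split => //; exact: dec.
have rho0 : 0 < rho by lra.
have step (M : R) k i : 0 < M -> M <= Num.max (Lf * rho) gamma ->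
    L k = M * rho ^+ i -> sufficient_decrease f g (M * rho ^+ i) (x k) ->
    (forall j, (j < i)%N -> ~ sufficient_decrease f g (M * rho ^+ j) (x k)) ->
    [/\ 0 < L k, L k <= Num.max (Lf * rho) gamma &
        sufficient_decrease f g (L k) (x k)].
  move=> M0 Mle LkE; rewrite -LkE => Lk_dec trials.
  split => //; first by rewrite LkE mulr_gt0// exprn_gt0.
  case: i LkE trials => [|i] LkE trials; first by rewrite LkE expr0 mulr1.
  rewrite LkE le_max exprSr mulrA ler_pM2r//; apply/orP; left.
  rewrite leNgt; apply/negP => /ltW Lf_le; exact: (trials i _ (dec _ _ Lf_le)).
elim=> [|k [Lk0 Lkle _]].
  have [i [LE Ldec trials]] := Lrule 0%N.
  by apply: (step gamma 0%N i) => //; rewrite le_max lexx orbT.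
by have [i [LE Ldec trials]] := Lrule k.+1; exact: (step (L k) k.+1 i).
Qed.

End ProximalGradient.

(** * Rates for the scalar recursion *)

Section Rates.
Context {R : realType}.
Implicit Types (a : nat -> R) (alpha B t : R).

(** Concavity of the logarithm between [1] and [1 + t]. *)
Lemma powR_bernoulli t alpha : 0 <= t -> 0 <= alpha <= 1 ->
  (1 + t) `^ alpha <= 1 + alpha * t.
Proof.
move=> t0 /andP[a0 a1]; have at0 : 0 <= alpha * t by rewrite mulr_ge0.
rewrite -ler_ln ?posrE ?powR_gt0; [|lra..].
rewrite ln_powR.
have := concave_ln (Itv01 a0 a1) (_ : 0 < (1 + t : R^o)) (ltr01 : 0 < (1 : R^o)).
rewrite !convRE /= /unstable.onem ln1 mulr0 addr0 => /(_ _) le.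
apply: le_trans (le _) _; first by lra.
by rewrite ler_ln ?posrE; lra.
Qed.

Lemma powR_natS_ge1 alpha k : 0 <= alpha -> 1 <= (k.+1%:R : R) `^ alpha.
Proof.
move=> a0; have k1 : (1 : R) <= k.+1%:R by rewrite ler1n.
by have := ler_powR k1 a0; rewrite powRr0.
Qed.

Lemma inv_powR_natS_in01 alpha k : 0 <= alpha ->
  0 < (k.+1%:R : R) `^ (- alpha) <= 1.
Proof.
move=> a0; rewrite powR_gt0 ?ltr0n//= powRN invf_le1 ?powR_gt0 ?ltr0n//.
exact: powR_natS_ge1.
Qed.

(** Induction with the constant [C = B / (1 - alpha)]. Put [u = m^alpha],
    [U = (m + 1)^alpha] and [w = U / u]. The step from [m] to [m + 1] amounts to
    [(U - 1)(w - 1) <= 1 - B / C = alpha], and Bernoulli bounds the left side by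
    [(alpha m)(alpha / m) = alpha^2]. *)
Lemma powR_rate a alpha B : 0 <= alpha < 1 -> 0 <= B ->
  (forall k, a k.+1 <= (1 - k.+1%:R `^ (- alpha)) * a k
                       + B * (k.+1%:R `^ (- alpha)) ^+ 2) ->
  forall k, a k.+1 <= B / (1 - alpha) / k.+1%:R `^ alpha.
Proof.
move=> /andP[a0 a1] B0 rec; have a1' : 0 < 1 - alpha by lra.
set C := B / (1 - alpha).
have CE : C * (1 - alpha) = B by rewrite /C divfK// gt_eqF.
have C0 : 0 <= C by rewrite divr_ge0// ltW.
elim=> [|k IH].
  by have := rec 0%N; rewrite !powR1 divr1 subrr mul0r add0r expr1n mulr1; nra.
apply: le_trans (rec _) _; rewrite !powRN.
set u : R := k.+1%:R `^ alpha in IH *; set U : R := k.+2%:R `^ alpha.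
pose m : R := k.+1%:R; have m0 : 0 < m by rewrite /m ltr0n.
have u0 : 0 < u by rewrite powR_gt0.
have U1 : 1 <= U := powR_natS_ge1 _ _ a0.
have U0 : 0 < U by lra.
have a01 : 0 <= alpha <= 1 by rewrite a0 ltW.
have Ule : U - 1 <= alpha * m.
  have := powR_bernoulli _ _ (ltW m0) a01.
  by rewrite /m -(natrD _ 1) add1n -/U; lra.
have wE : U = u * (1 + m^-1) `^ alpha.
  rewrite /U /u -powRM//; last by rewrite addr_ge0// invr_ge0 ltW.
  by rewrite mulrDr mulr1 divff ?gt_eqF// -(natrD _ _ 1) addn1.
have w1 := powR_bernoulli _ _ (ltW (_ : 0 < m^-1)) a01.
move: w1; rewrite invr_gt0 => /(_ m0); set w := (1 + m^-1) `^ alpha in wE * => w1.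
have key : (U - 1) * (w - 1) <= alpha ^+ 2.
  apply: (@le_trans _ _ ((U - 1) * (alpha / m))).
    by rewrite ler_wpM2l ?subr_ge0// lerBlDl.
  apply: (@le_trans _ _ (alpha * m * (alpha / m))).
    by rewrite ler_wpM2r// divr_ge0// ltW.
  by rewrite mulrACA divff ?gt_eqF// mulr1 expr2.
have UV : U * U^-1 = 1 by rewrite divff// gt_eqF.
have uV : u^-1 = w * U^-1.
  by rewrite wE invfM mulrCA divff ?mulr1// gt_eqF// /w powR_gt0// addr_gt0// invr_gt0.
apply: (@le_trans _ _ ((1 - U^-1) * (C / u) + B * U^-1 ^+ 2)).
  by rewrite lerD2r ler_wpM2l// subr_ge0 invf_le1.
rewrite uV.
have -> : (1 - U^-1) * (C * (w * U^-1)) + B * U^-1 ^+ 2 =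
    U^-1 ^+ 2 * (C * ((U - 1) * w) + B).
  by rewrite -{1}UV; ring.
have -> : C / U = U^-1 ^+ 2 * (C * U) by rewrite -[LHS]mulr1 -UV; ring.
rewrite ler_wpM2l ?sqr_ge0//.
have := ler_wpM2l C0 key.
by nra.
Qed.

(** Multiplying by [k + 1] telescopes the recursion into a harmonic sum, whose
    terms satisfy [1 / (k + 2) <= ln (k + 2) - ln (k + 1)]. *)
Lemma harmonic_rate a B : 0 <= B ->
  (forall k, a k.+1 <= (1 - k.+1%:R^-1) * a k + B * k.+1%:R^-1 ^+ 2) ->
  forall k, a k.+1 <= B * ((ln k.+1%:R + 1) / k.+1%:R).
Proof.
move=> B0 rec k; have pos j : (0 : R) < j.+1%:R by rewrite ltr0n.
suff : k.+1%:R * a k.+1 <= B * (ln k.+1%:R + 1).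
  by rewrite mulrA ler_pdivlMr// mulrC.
have mul_rec j : j.+1%:R * a j.+1 <= j%:R * a j + B * j.+1%:R^-1.
  have := ler_wpM2l (ltW (pos j)) (rec j).
  have jV : j.+1%:R * j.+1%:R^-1 = 1 :> R by rewrite divff// gt_eqF.
  have -> : j.+1%:R * ((1 - j.+1%:R^-1) * a j + B * j.+1%:R^-1 ^+ 2) =
    (j.+1%:R - j.+1%:R * j.+1%:R^-1) * a j
    + B * j.+1%:R^-1 * (j.+1%:R * j.+1%:R^-1) by ring.
  by rewrite jV mulr1 -natr1 addrK.
elim: k => [|k IH].
  by have := mul_rec 0%N; rewrite ln1 invr1 mul0r !mulr1 !add0r mulr1.
apply: le_trans (mul_rec _) _.
have ln_step : k.+2%:R^-1 <= ln k.+2%:R - ln k.+1%:R :> R.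
  have V1 : k.+2%:R^-1 < 1 :> R by rewrite invf_lt1// ltr1n.
  have := @le_ln1Dx R (- k.+2%:R^-1); rewrite ltrN2 => /(_ V1).
  have -> : 1 - k.+2%:R^-1 = k.+1%:R / k.+2%:R :> R.
    have k2 : k.+2%:R != 0 :> R by rewrite gt_eqF.
    by apply: (mulIf k2); rewrite mulrBl mulVf// divfK// mul1r -natr1 addrK.
  by rewrite ln_div ?posrE// -[in X in _ -> X]lerN2 opprB.
apply: (@le_trans _ _ (B * (ln k.+1%:R + 1) + B * k.+2%:R^-1)).
  by rewrite lerD2r.
by rewrite -mulrDr ler_wpM2l// addrAC lerD2r addrC -lerBrDr.
Qed.

End Rates.

(** * The bilevel recursion *)

Section BilevelStep.
Context {R : realType} {n : nat}.
Implicit Types (u v x y : 'rV[R]_n).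

Lemma sqr_enorm_combination_le u v (p q a b : R) : enorm u <= p -> enorm v <= q ->
  0 <= a -> 0 <= b -> enorm (a *: u - b *: v) ^+ 2 <= (a * p + b * q) ^+ 2.
Proof.
move=> up vq a0 b0.
have p0 := le_trans (enorm_ge0 u) up; have q0 := le_trans (enorm_ge0 v) vq.
have vN : enorm (- v) = enorm v by rewrite /enorm dotvNl dotvNr opprK.
have cross : dotv u (- v) <= p * q by apply: dotv_le_mul; rewrite ?vN.
have upp : enorm u ^+ 2 <= p ^+ 2 by rewrite lerXn2r// nnegrE enorm_ge0.
have vqq : enorm v ^+ 2 <= q ^+ 2 by rewrite lerXn2r// nnegrE enorm_ge0.
have -> : enorm (a *: u - b *: v) ^+ 2 =
    a ^+ 2 * enorm u ^+ 2 + 2 * (a * b) * dotv u (- v) + b ^+ 2 * enorm v ^+ 2.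
  by rewrite !enorm_sqr !dotvE (dotvC v u); ring.
have -> : (a * p + b * q) ^+ 2 =
    a ^+ 2 * p ^+ 2 + 2 * (a * b) * (p * q) + b ^+ 2 * q ^+ 2 by ring.
by rewrite !lerD// ler_wpM2l// ?sqr_ge0// !mulr_ge0.
Qed.

(** The proximal gradient inequality is applied not at the minimizer [x'] but at
    the point [theta x' + (1 - theta) y] between it and the previous inner
    iterate [y]. This point is within [theta (D1 + D2)] of [y - eta v] as soon as
    [eta <= theta], so the perturbation by the outer step is absorbed in the
    second-order term. *)
Lemma perturbed_prox_grad_contraction (f : 'rV[R]_n -> R) (g : 'rV[R]_n -> \bar R)
    (Lf L Lbar theta eta D1 D2 gx' gy gy' : R) x' y v :
  smooth_convex Lf f -> proper_lsc_convex g -> inner_sol f g !=set0 ->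
  let x := y - eta *: v in let y' := prox_grad (1 / L) f g x in
  0 < L -> L <= Lbar -> sufficient_decrease f g L x ->
  0 <= eta -> eta <= theta -> theta <= 1 ->
  enorm (x - x') <= D1 -> enorm v <= D2 ->
  g x' = gx'%:E -> g y = gy%:E -> g y' = gy'%:E ->
  f y' + gy' - (f x' + gx') <=
    (1 - theta) * (f y + gy - (f x' + gx'))
    + (D1 + D2) ^+ 2 * Lbar / 2 * theta ^+ 2.
Proof.
move=> fs gp sol x y' L0 LLbar dec eta0 eta_theta theta1 xD1 vD2 gx'E gyE gy'E.
have [fconv _ _ _] := fs; have [[gNy _] _ gconv] := gp.
have theta0 := le_trans eta0 eta_theta.
have theta01 : 0 <= theta <= 1 by rewrite theta0.
set z := theta *: x' + (1 - theta) *: y.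
have fz : f z <= theta * f x' + (1 - theta) * f y.
  exact: (fconv (Itv01 theta0 theta1) x' y (mem_setT _) (mem_setT _)).
have [gz gzE gz_le] : exists2 gz : R, g z = gz%:E &
    gz <= theta * gx' + (1 - theta) * gy.
  have := gconv x' y theta theta01; rewrite -/z gx'E gyE -!EFinM -EFinD.
  by case: (g z) (gNy z) => [gz| |]// _; rewrite lee_fin; exists gz.
have [gp' gp'E] := prox_grad_ineq _ _ _ fs gp _ _ _ _ sol L0 dec gzE.
have -> : gp' = gy' by move: gp'E; rewrite gy'E => -[].
rewrite -/y' => descent.
have dist : enorm (x - z) ^+ 2 <= (theta * (D1 + D2)) ^+ 2.
  have -> : x - z = theta *: (x - x') - ((1 - theta) * eta) *: v.
    by apply/rowP => i; rewrite !mxE; ring.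
  have w0 : 0 <= (1 - theta) * eta by rewrite mulr_ge0// subr_ge0.
  apply: le_trans (sqr_enorm_combination_le _ _ _ _ _ _ xD1 vD2 theta0 w0) _.
  have D1_ge0 := le_trans (enorm_ge0 _) xD1.
  have D2_ge0 := le_trans (enorm_ge0 _) vD2.
  apply: lerXn2r; rewrite ?nnegrE.
  - by rewrite addr_ge0// mulr_ge0.
  - by rewrite mulr_ge0// addr_ge0.
  rewrite mulrDr lerD2l ler_wpM2r//; apply: le_trans eta_theta.
  by rewrite ler_piMl// gerBl.
have := ler_wpM2r (sqr_ge0 (theta * (D1 + D2))) LLbar.
have := ler_wpM2l (ltW L0) dist.
by lra.
Qed.

End BilevelStep.

Theorem theorem2 (R : realType) (n : nat)
    (f : 'rV[R]_n -> R) (g : 'rV[R]_n -> \bar R) (omega : 'rV[R]_n -> R)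
    (Lf : R) (Lf_gt0 : 0 < Lf)
    (f_smooth : smooth_convex Lf f) (g_plc : proper_lsc_convex g)
    (Xstar_neq0 : inner_sol f g !=set0)
    (omega_convex : convex_function [set: convex_lmodType 'rV[R]_n] omega)
    (omega_coercive : coercive omega)
    (alpha c : R) (alpha_bounds : 1 / 2 < alpha <= 1) (c_gt0 : 0 < c)
    (x y : nat -> 'rV[R]_n) (Omega : nat -> 'rV[R]_n -> 'rV[R]_n)
    (L : nat -> R) (Lbar : R)
    (version : version_I omega c Omega \/ version_II omega c alpha Omega)
    (stepsize : constant_rule Lf L Lbar \/ backtracking_rule f g Lf x L Lbar)
    (y_step : forall k, y k = prox_grad (1 / L k) f g (x k))
    (x_step : forall k,
      x k.+1 = y k - outer_step c alpha k *: Omega k (y k))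
    (x' : 'rV[R]_n) (x'_outer_sol : outer_sol f g omega x')
    (D1 D2 : R) (D1_gt0 : 0 < D1) (D2_gt0 : 0 < D2)
    (x_bounded : forall k, enorm (x k - x') <= D1)
    (Omega_bounded : forall k, enorm (Omega k (y k)) <= D2)
    (k : nat) (k_ge1 : (1 <= k)%N) :
  (inner_obj f g (y k) - inner_obj f g x'
     <= (2 * H_const alpha (D1 + D2) Lbar * rate alpha k)%:E)%E.
Proof.
have [x'_min _] := x'_outer_sol.
have [gx' gx'E] := inner_sol_fin _ _ g_plc _ x'_min.
have L_ok := stepsize_bounds _ _ _ f_smooth _ _ _ Lf_gt0 stepsize.
have alpha0 : 0 <= alpha by lra.
have c1 : c <= 1.
  case: version => [[]//|[? [? [? [_ _ _ + _]]]]].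
  by rewrite le_min => /andP[].
have /choice[gy gyE] : forall j, exists r : R, g (y j) = r%:E.
  move=> j; have [Lj0 _ dec] := L_ok j; rewrite y_step.
  have [r rE _] := prox_grad_ineq _ _ _ f_smooth g_plc _ _ _ _ Xstar_neq0 Lj0 dec gx'E.
  by exists r.
pose gap j := f (y j) + gy j - (f x' + gx').
set D := D1 + D2; pose B := D ^+ 2 * Lbar / 2.
have Lbar0 : 0 <= Lbar by have [Lk0 Lk _] := L_ok 0%N; lra.
have B0 : 0 <= B by rewrite divr_ge0 ?ler0n// mulr_ge0 ?sqr_ge0//.
have gap_rec j : gap j.+1 <= (1 - j.+1%:R `^ (- alpha)) * gap j
    + B * (j.+1%:R `^ (- alpha)) ^+ 2.
  have [Lj0 LjLbar dec] := L_ok j.+1.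
  have /andP[theta0 theta1] := @inv_powR_natS_in01 R _ j alpha0.
  have := gyE j.+1; rewrite y_step; move: dec (x_bounded j.+1).
  rewrite x_step => dec xD1 gyE'.
  rewrite /gap [y j.+1]y_step x_step.
  apply: (perturbed_prox_grad_contraction _ _ _ _ _ _ _ _ _ _ _ _ _ _ _
    f_smooth g_plc Xstar_neq0 Lj0 LjLbar dec _ _ theta1 xD1 (Omega_bounded j)
    gx'E (gyE j) gyE').
  - by rewrite mulr_ge0// ltW.
  - by rewrite ler_piMl// ltW.
rewrite /inner_obj gyE gx'E -!EFinD lee_fin -/(gap k).
case: k k_ge1 => // k _; rewrite /H_const /rate -/D.
case: ifPn => [/eqP alpha1|alpha1].
  have := @harmonic_rate R gap B B0.
  move=> /(_ _ k) rate_k; apply: le_trans (rate_k _) _.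
    by move=> j; have := gap_rec j; rewrite alpha1 powR_inv1.
  rewrite ler_wpM2r//; last by rewrite /B; nra.
  by rewrite divr_ge0// addr_ge0// ln_ge0// ler1n.
have alpha_lt1 : alpha < 1 by rewrite lt_neqAle alpha1; case/andP: alpha_bounds.
have alpha_in : 0 <= alpha < 1 by rewrite alpha0.
apply: le_trans (powR_rate _ _ _ alpha_in B0 gap_rec k) _.
rewrite div1r ler_wpM2r ?invr_ge0 ?powR_ge0// /B mulrAC [X in _ <= X]mulrC.
rewrite ler_wpM2l//; last lra.
by apply: divr_ge0; [rewrite mulr_ge0 ?sqr_ge0|lra].
Qed.
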